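(* Let $G$ be a finite group and let $H$ be a non-trivial subgroup of $G$. Then for every integer $a$ and every even integer $b$ with $0\leq a\leq |H|-1$ and $0\leq b\leq |H|$ such that $\gcd(2,|H|-1)$ divides $a$, the subgroup $H$ is an $(a,b)$-regular set of $G$.
   Context: For a finite group $G$ and an inverse-closed subset $S$ of $G\setminus\{1\}$ (i.e. $s\in S$ implies $s^{-1}\in S$), the Cayley graph $\mathrm{Cay}(G,S)$ is the simple graph with vertex set $G$ in which $x,y\in G$ are adjacent if and only if $yx^{-1}\in S$. For non-negative integers $a,b$, a subset $C$ of the vertex set of a simple graph $\Gamma$ is an $(a,b)$-regular set in $\Gamma$ if every vertex of $C$ is adjacent to exactly $a$ vertices of $C$ and every vertex outside $C$ is adjacent to exactly $b$ vertices of $C$. A subset $C$ of $G$ is called an $(a,b)$-regular set of $G$ if it is an $(a,b)$-regular set in $\mathrm{Cay}(G,S)$ for some inverse-closed subset $S$ of $G\setminus\{1\}$ (where $S$ may depend on $a$ and $b$). *)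

(* Defs.v *)
From mathcomp Require Import all_boot all_fingroup.

Set Implicit Arguments.
Unset Strict Implicit.
Unset Printing Implicit Defensive.

Import GroupScope.

(* A simple graph on a finite vertex type T is given by its adjacency
   relation, which is symmetric and irreflexive. *)
Definition simple_graph (T : finType) (e : rel T) : Prop :=
  symmetric e /\ irreflexive e.

Definition regular_set (T : finType) (e : rel T) (a b : nat) (C : {set T}) :
    Prop :=
  (forall x, x \in C -> #|[set y in C | e x y]| = a) /\
  (forall x, x \notin C -> #|[set y in C | e x y]| = b).

Definition inverse_closed (gT : finGroupType) (S : {set gT}) : Prop :=
  forall s, s \in S -> s^-1 \in S.

Definition cayley (gT : finGroupType) (S : {set gT}) : rel gT :=
  fun x y => y * x^-1 \in S.

Lemma cayley_simple (gT : finGroupType) (S : {set gT}) :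
  S \subset [set: gT] :\ 1 -> inverse_closed S -> simple_graph (cayley S).
Proof.
move=> /subsetD1P[_ S1] SV; split=> [x y | x]; rewrite /cayley.
  by apply/idP/idP => /SV; rewrite invMg invgK.
by rewrite mulgV; apply: negbTE.
Qed.

(* The group is the whole type gT, so that the vertex set of the Cayley graph
   is gT. *)
Definition group_regular_set (gT : finGroupType) (a b : nat) (C : {set gT}) :
    Prop :=
  exists S : {set gT},
    [/\ S \subset [set: gT] :\ 1,
        inverse_closed S
      & regular_set (cayley S) a b C].

(* Main.v *)
Require Import Defs.
From mathcomp Require Import all_boot all_fingroup.
From mathcomp Require Import ssralg zmodp.

Set Implicit Arguments.
Unset Strict Implicit.
Unset Printing Implicit Defensive.

Import GroupScope.

(* A set S makes H an (a, b)-regular set of Cay(G, S) iff #|S :&: H| = a and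
   #|S :&: H x| = b for every right coset H x <> H.  Regard s as an arc from
   H s to H s^-1, so that inversion reverses arcs: then S amounts to a
   subgraph of this multigraph on right cosets, and any symmetric table of
   arc multiplicities within capacity can be realised, provided odd diagonal
   entries occur only where the number of loops is odd (inverse-closed sets
   are then available).  The arcs leaving H t reach exactly the n right cosets
   contained in H t^-1 H, and each of them #|H| / n times; hence the table can
   be a circulant matrix with row sums b on every pair of mutually inverse
   double cosets. *)

(** * Subsets of prescribed size stable under an involution *)

Lemma exists_subset_card (T : finType) (X : {set T}) (c : nat) :
  c <= #|X| -> exists2 Y : {set T}, Y \subset X & #|Y| = c.
Proof.
move=> lec; exists [set y in take c (enum X)].
  by apply/subsetP=> y; rewrite inE => /mem_take; rewrite mem_enum.
rewrite cardsE (card_uniqP _) ?take_uniq ?enum_uniq // size_takel //.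
by rewrite -cardE.
Qed.

Section Involution.

Variables (T : finType) (f : T -> T).
Hypothesis fK : involutive f.

Definition stable (X : {set T}) : Prop := forall x, x \in X -> f x \in X.

(** Points moved by [f] come in pairs [x], [f x], which are peeled off by induction; once [f] fixes
    [X] pointwise, every subset is stable. *)
Lemma stable_subset (X : {set T}) (c : nat) :
    stable X -> c <= #|X| -> (odd c -> odd #|X|) ->
  exists Y : {set T}, [/\ Y \subset X, #|Y| = c & stable Y].
Proof.
have [k] := ubnP #|X|; elim: k X c => // k IHk X c ltXk stX lecX oddc.
have [[x /andP[Xx nfx]] | fixX] :=
  altP (@existsP T (fun x => (x \in X) && (f x != x))).
  have [->|neqc] := eqVneq c #|X|; first by exists X.
  pose X' := X :\ x :\ f x.
  have cardX : #|X| = #|X'|.+2.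
    by rewrite (cardsD1 x) Xx (cardsD1 (f x)) !inE nfx stX.
  have stX' : stable X'.
    move=> y; rewrite !inE !(inv_eq fK) fK.
    by case/and3P=> -> -> /stX ->.
  have ltX'k : #|X'| < k by rewrite cardX in ltXk; apply: ltnW.
  have X'sub : X' \subset X.
    exact: subset_trans (subsetDl _ _) (subsetDl _ _).
  have [lecX' | ltX'c] := leqP c #|X'|.
    have [|Y [sYX' cardY stY]] := IHk X' c ltX'k stX' lecX'.
      by rewrite cardX /= negbK in oddc.
    by exists Y; split=> //; apply: subset_trans X'sub.
  (* Now [c] is one less than [#|X|], hence even by [oddc]: the pair is kept and completed by a
     stable subset of [X'] of size [c - 2]. *)
  have {neqc lecX ltX'c} defc : c = #|X'|.+1.
    apply/eqP; rewrite eqn_leq ltX'c andbT -ltnS -cardX.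
    by rewrite ltn_neqAle neqc.
  have evc : ~~ odd c.
    apply/negP=> odd_c; have := oddc odd_c; move: odd_c.
    by rewrite defc cardX /=; case: odd.
  case: c => [|[|c]] in defc evc oddc *.
  - by exists set0; rewrite sub0set cards0; split=> // y; rewrite inE.
  - by [].
  have [||Y [sYX' cardY stY]] := IHk X' c ltX'k stX'.
  - by case: defc => <-.
  - by rewrite /= negbK in evc; rewrite (negbTE evc).
  exists (x |: (f x |: Y)).
  have notY y : y \notin X' -> y \notin Y by apply: contra => /(subsetP sYX').
  split.
  - apply/subsetP=> y; rewrite !inE => /or3P[/eqP->|/eqP->|/(subsetP sYX')] //.
      exact: stX.
    exact: (subsetP X'sub).
  - rewrite !cardsU1 cardY !inE eq_sym (negbTE nfx) /=.
    by rewrite !notY // !inE ?eqxx ?andbF.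
  - move=> y; rewrite !inE !(inv_eq fK) fK.
    by case/or3P=> [->|->|/stY ->]; rewrite ?orbT.
have [Y sYX cardY] := exists_subset_card lecX; exists Y; split=> // y yY.
move: fixX; rewrite negb_exists => /forallP/(_ y).
by rewrite (subsetP sYX _ yY) negbK => /eqP->.
Qed.

Lemma odd_stable_fixpoint (X : {set T}) :
  stable X -> odd #|X| -> exists2 x, x \in X & f x = x.
Proof.
move=> stX oddX.
have [|//|Y [sYX /eqP/cards1P[x defY] stY]] := @stable_subset X 1 stX.
  exact: odd_gt0.
exists x; first by rewrite (subsetP sYX) // defY set11.
by apply/set1P; rewrite -defY; apply: stY; rewrite defY set11.
Qed.

(** * Multigraphs with arc reversal *)

Variables (V : finType) (src : T -> V).

(* [T] is viewed as the set of arcs of a directed multigraph on [V], with [f]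
   reversing arcs. *)
Definition arcs (E : {set T}) (v w : V) :=
  [set t in E | (src t == v) && (src (f t) == w)].

Lemma card_arcsC (E : {set T}) v w :
  stable E -> #|arcs E v w| = #|arcs E w v|.
Proof.
move=> stE; rewrite -[RHS](card_imset _ (can_inj fK)); congr #|pred_of_set _|.
apply/setP=> t; rewrite -{2}[t]fK (mem_imset _ _ (can_inj fK)) !inE fK.
rewrite [X in _ = _ && X]andbC; congr (_ && _).
by apply/idP/idP=> /stE; rewrite ?fK.
Qed.

Lemma card_arcs_row (E : {set T}) v :
  #|[set t in E | src t == v]| = \sum_w #|arcs E v w|.
Proof.
rewrite -sum1_card (partition_big (src \o f) predT) //=.
apply: eq_bigr => w _; rewrite -sum1_card; apply: eq_bigl => t.
by rewrite !inE andbA.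
Qed.

(** Between distinct vertices [f] exchanges the two directions, so one is chosen freely and the
    other is its image; only loops need a stable choice, hence the parity condition. *)
Lemma stable_arcs_subset (E : {set T}) (c : V -> V -> nat) :
    stable E -> (forall v w, c v w = c w v) ->
    (forall v w, c v w <= #|arcs E v w|) ->
    (forall v, odd (c v v) -> odd #|arcs E v v|) ->
  exists S : {set T},
    [/\ S \subset E, stable S & forall v w, #|arcs S v w| = c v w].
Proof.
move=> stE cC lec oddc.
have /fin_all_exists[X] (p : V * V) : exists Y : {set T},
  [/\ Y \subset arcs E p.1 p.2, #|Y| = c p.1 p.2 & p.1 = p.2 -> stable Y].
  case: p => v w /=; have [<-|neq] := eqVneq v w.
    have [||Y [? ? ?]] := @stable_subset (arcs E v v) (c v v) _ _ (oddc v).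
    - by move=> t; rewrite !inE fK => /and3P[/stE-> -> ->].
    - exact: lec.
    by exists Y.
  have [Y sY cardY] := exists_subset_card (lec v w).
  by exists Y; split=> // /eqP; rewrite (negbTE neq).
move=> XP.
(* [enum_rank] decides which of the two directions carries the free choice. *)
pose Z v w := if enum_rank v <= enum_rank w then X (v, w)
              else f @^-1: X (w, v).
have ZC v w t : t \in Z v w -> f t \in Z w v.
  rewrite /Z; case: ltngtP => [ltvw|ltwv|].
  - by rewrite inE fK.
  - by rewrite inE.
  - move/ord_inj/enum_rank_inj=> -> tX.
    by have [_ _ stX] := XP (w, w); apply: stX.
have Zsub v w : Z v w \subset arcs E v w.
  rewrite /Z; case: ifP => _; first by have [] := XP (v, w).
  apply/subsetP=> t; rewrite inE.
  have [/subsetP sub _ _ /sub] := XP (w, v).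
  by rewrite !inE fK => /and3P[/stE]; rewrite fK => -> -> ->.
have Zcard v w : #|Z v w| = c v w.
  rewrite /Z; case: ifP => _; first by have [] := XP (v, w).
  rewrite on_card_preimset; first by have [_ -> _] := XP (w, v).
  exact: onW_bij (inv_bij fK).
exists [set t in E | t \in Z (src t) (src (f t))]; split.
- by apply/subsetP=> t; rewrite inE => /andP[].
- by move=> t; rewrite !inE fK => /andP[/stE-> /ZC].
move=> v w; rewrite -Zcard; congr #|pred_of_set _|; apply/setP=> t.
apply/idP/idP => [|tZ].
  by rewrite !inE => /and3P[/andP[_ tZ] /eqP<- /eqP<-].
have := subsetP (Zsub v w) t tZ.
by rewrite !inE => /and3P[-> /eqP-> /eqP->]; rewrite tZ !eqxx.
Qed.

End Involution.

(** * Symmetric matrices with constant row sums *)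

(* A circulant matrix [F (i - j)], where [F k] counts the pairs with first
   component [k] in a subset of [Z_n * 'I_m] of size [b] stable under
   [(k, u) |-> (- k, m - 1 - u)]; if [F 0] is odd then [u |-> m - 1 - u] has a
   fixed point. *)
Lemma symmetric_matrix_const_sum (n m b : nat) :
    b <= n * m -> ~~ odd b ->
  exists c : nat -> nat -> nat,
    [/\ forall i j, c i j <= m, forall i j, c i j = c j i,
        forall i, odd (c i i) -> odd m
      & forall i, i < n -> \sum_(j < n) c i j = b].
Proof.
case: n => [|n] leb evb; first by exists (fun _ _ => 0).
pose g (p : 'I_n.+1 * 'I_m) := (- p.1, rev_ord p.2)%R.
have gK : involutive g by case=> k u; rewrite /g /= GRing.opprK rev_ordK.
have [|||Y [_ cardY stY]] := @stable_subset _ g gK setT b.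
- by move=> p; rewrite !inE.
- by rewrite cardsT card_prod !card_ord.
- by move=> ob; rewrite ob in evb.
pose Yk (k : 'I_n.+1) := [set u | (k, u) \in Y].
have rYk k u : u \in Yk k -> rev_ord u \in Yk (- k)%R.
  by rewrite !inE => /stY.
have leYN k : #|Yk k| <= #|Yk (- k)%R|.
  rewrite -(card_imset _ (@rev_ord_inj m)); apply/subset_leq_card/subsetP.
  by move=> _ /imsetP[u uY ->]; apply: rYk.
have cardYN k : #|Yk (- k)%R| = #|Yk k|.
  by apply/eqP; rewrite eqn_leq leYN andbT -{2}[k]GRing.opprK leYN.
exists (fun i j => #|Yk (inord i - inord j)%R|); split.
- by move=> i j; rewrite -[leqRHS]card_ord max_card.
- by move=> i j; rewrite -cardYN GRing.opprB.
- move=> i; rewrite GRing.subrr => odd0.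
  have [|u _ ru] := odd_stable_fixpoint (@rev_ordK m) _ odd0.
    by move=> u /rYk; rewrite GRing.oppr0.
  have /(congr1 val)/= := ru; have := ltn_ord u => ltum eqmu.
  by rewrite -(subnK ltum) eqmu addnS oddS addnn odd_double.
move=> i ltin.
(* With [k = i - j], the row sum adds up all fibres [Yk k] of [Y]. *)
rewrite (reindex_inj (h := fun j : 'I_n.+1 => inord i - j)%R); last first.
  by move=> j k /GRing.addrI/GRing.oppr_inj.
rewrite -cardY -[RHS]sum1_card (partition_big fst predT) //.
apply: eq_bigr => k _.
rewrite inord_val GRing.subKr -[LHS]sum1_card.
rewrite (reindex (pair k)) /=.
  by apply: eq_bigl => u; rewrite !inE eqxx andbT.
exists snd => // -[k' u]; rewrite !inE /= => /andP[_ /eqP <-] //.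
Qed.

(** One matrix is fixed per divisor [n], so that mutually inverse double cosets, having equally many
    right cosets, share the same one. *)
Lemma symmetric_matrix_family (N b : nat) :
    0 < N -> b <= N -> ~~ odd b ->
  exists c : nat -> nat -> nat -> nat, forall n, n %| N ->
    [/\ forall i j, c n i j <= N %/ n, forall i j, c n i j = c n j i,
        forall i, odd (c n i i) -> odd (N %/ n)
      & forall i, i < n -> \sum_(j < n) c n i j = b].
Proof.
move=> N_gt0 leb evb.
have /fin_all_exists[c cP] (n : 'I_N.+1) : exists c : nat -> nat -> nat,
    n %| N ->
    [/\ forall i j, c i j <= N %/ n, forall i j, c i j = c j i,
        forall i, odd (c i i) -> odd (N %/ n)
      & forall i, i < n -> \sum_(j < n) c i j = b].
  have [nN | ?] := boolP (n %| N); last by exists (fun _ _ => 0).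
  have [|c cP] := @symmetric_matrix_const_sum n (N %/ n) b _ evb.
    by rewrite mulnC divnK.
  by exists c.
exists (fun n => c (inord n)) => n nN.
have defn : (inord n : 'I_N.+1) = n :> nat by rewrite inordK // ltnS dvdn_leq.
by have := cP (inord n); rewrite defn => /(_ nN).
Qed.

Lemma big_index_enum (V : finType) (Q : {set V}) (F : nat -> nat) :
  \sum_(v in Q) F (index v (enum Q)) = \sum_(j < #|Q|) F j.
Proof.
rewrite -big_enum /=; have [/eqP|] := posnP #|Q|.
  by rewrite cards_eq0 => /eqP->; rewrite enum_set0 cards0 big_nil big_ord0.
case/card_gt0P=> v0 _; rewrite (big_nth v0) cardE big_mkord.
by apply: eq_bigr => j _; rewrite index_uniq ?enum_uniq.
Qed.

(** * Right cosets inside a double coset *)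

Section RightCosets.

Variables (gT : finGroupType) (H : {group gT}).

Let src (t : gT) : {set gT} := H :* t.
(* The right cosets contained in the double coset [A * H]. *)
Let class (A : {set gT}) := orbit 'Rs H A.

(** The arcs are the [h^-1 * t] with [h] in [H] carrying [H t^-1] to [B]; such [h] form a coset of a
    stabiliser, so orbit-stabiliser applies. *)
Lemma card_rcoset_arcs t (B : {set gT}) : B \in class (src t^-1) ->
  (#|class (src t^-1)| * #|arcs invg src setT (src t) B|)%N = #|H|.
Proof.
case/imsetP=> k kH ->; rewrite -(card_orbit_stab 'Rs H (src t^-1)).
congr (_ * _)%N.
rewrite -[RHS](card_rcoset _ k) -(amove_act _ _ (subsetT H) kH).
rewrite -[RHS](card_imset _ (inj_comp (mulIg t) invg_inj)).
congr #|pred_of_set _|; apply/setP=> s; apply/idP/imsetP.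
  rewrite !inE /= => /andP[/eqP st /eqP sk].
  have : s \in H :* t by apply/rcoset_eqP.
  case/rcosetP=> h hH defs; rewrite {s st}defs in sk *.
  exists h^-1; last by rewrite /= invgK.
  rewrite !inE groupV hH /= -sk rcosetE.
  by rewrite /src invMg rcosetM.
case=> h; rewrite !inE => /andP[hH /eqP hk] -> /=.
rewrite -hk /= rcosetE /src rcosetM (rcoset_id (groupVr hH)) eqxx.
by rewrite invMg invgK rcosetM eqxx.
Qed.

Lemma mem_rcoset_class t s : src s = src t -> src s^-1 \in class (src t^-1).
Proof.
move=> st; have : s \in H :* t by apply/rcoset_eqP.
case/rcosetP=> h hH ->; apply/imsetP; exists h^-1; first by rewrite groupV.
by rewrite /= rcosetE /src invMg rcosetM.
Qed.

Lemma class_arcs t (B : {set gT}) : B \in class (src t^-1) ->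
  exists2 s, src s = src t & src s^-1 = B.
Proof.
case/imsetP=> k kH ->; exists (k^-1 * t).
  by rewrite /src rcosetM (rcoset_id (groupVr kH)).
by rewrite /= rcosetE /src invMg invgK rcosetM.
Qed.

(** Inversion matches the arcs from [H t] to [H t^-1] with those going back; this positive number
    times either class size is [#|H|]. *)
Lemma card_class_inv t : #|class (src t^-1)| = #|class (src t)|.
Proof.
have h1 := card_rcoset_arcs (orbit_refl 'Rs H (src t^-1)).
have := card_rcoset_arcs (orbit_refl 'Rs H (src t^-1^-1)); rewrite invgK.
rewrite (card_arcsC invgK) => [h2|s]; last by rewrite !inE.
apply/eqP; rewrite -(@eqn_pmul2r #|arcs invg src setT (src t) (src t^-1)|).
  by rewrite h1 h2.
by apply/card_gt0P; exists t; rewrite !inE !eqxx.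
Qed.

End RightCosets.

(** * Construction of the connection set *)

Theorem theoremB (gT : finGroupType) (H : {group gT}) (ntH : H :!=: 1%g)
    (a b : nat) (b_even : ~~ odd b)
    (a_le : a <= #|H| - 1) (b_le : b <= #|H|)
    (gcd_dvd_a : gcdn 2 (#|H| - 1) %| a) :
  group_regular_set a b H.
Proof.
pose src (t : gT) : {set gT} := H :* t.
pose class (A : {set gT}) := orbit 'Rs H A.
have [mx mxP] := symmetric_matrix_family (cardG_gt0 H) b_le b_even.
(* Row and column numbers are positions within a double coset. *)
pose r (A : {set gT}) := index A (enum (class A)).
pose adj (A B : {set gT}) := [exists t, (src t == A) && (src t^-1 == B)].
pose c (A B : {set gT}) :=
  if (A == H) && (B == H) then a else
  if adj A B then mx #|class A| (r A) (r B) else 0.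
have n_dvd t : #|class (src t)| %| #|H| by apply: dvdn_orbit.
have mxt t := mxP _ (n_dvd t).
have adjC A B : adj A B = adj B A.
  by apply/existsP/existsP=> -[t]; rewrite andbC => ?; exists t^-1;
    rewrite invgK.
have srcH t : (src t == H) = (t \in H).
  apply/eqP/idP => [<-|tH]; first exact: rcoset_refl.
  by rewrite /src rcoset_id.
(* Dropping 1 keeps it out of [S] and costs only one loop at [H]. *)
pose E := [set~ (1 : gT)].
have stE : stable invg E by move=> t; rewrite !inE invg_eq1.
have arcsH : #|arcs invg src E H H| = #|H| - 1.
  rewrite [#|H|](cardsD1 1) group1 add1n subn1 /=; congr #|pred_of_set _|.
  by apply/setP=> t; rewrite !inE !srcH groupV andbb.
have arcsE t : t \notin H ->
    #|arcs invg src E (src t) (src t^-1)| = #|H| %/ #|class (src t)|.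
  move=> tH; rewrite -card_class_inv.
  rewrite -[in RHS](card_rcoset_arcs (orbit_refl 'Rs H (src t^-1))).
  rewrite mulKn; last by apply/card_gt0P; exists (src t^-1); apply: orbit_refl.
  congr #|pred_of_set _|; apply/setP=> s; rewrite !inE /=.
  case: eqVneq => [->|//] /=; apply/esym/negbTE.
  by rewrite -[_ == src t]/(src 1 == src t) eq_sym [src 1]rcoset1 srcH (negbTE tH).
have ntadj (A B : {set gT}) : (A == H) && (B == H) = false -> adj A B ->
    exists t, [/\ t \notin H, A = src t & B = src t^-1].
  move=> nAB /existsP[t /andP[/eqP At /eqP Bt]]; exists t; split=> //.
  by move: nAB; rewrite -At -Bt !srcH groupV andbb => ->.
have [|||S [sSE stS cardS]] := @stable_arcs_subset _ _ invgK _ src E c stE.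
- move=> A B; rewrite /c andbC adjC; case: ifP => // BAH.
  case: ifP => // /(ntadj _ _ BAH)[t [_ -> ->]].
  have [_ symt _ _] := mxt t^-1.
  by rewrite -(card_class_inv H t) symt.
- move=> A B; rewrite /c; case: ifP => [/andP[/eqP-> /eqP->]|nAB].
    by rewrite arcsH.
  case: ifP => // /(ntadj _ _ nAB)[t [tH -> ->]].
  by rewrite arcsE //; have [] := mxt t.
- move=> A; rewrite /c; case: ifP => [/andP[/eqP-> _]|nAB].
    (* If [#|H| - 1] were even, the gcd would be 2 and [a] could not be odd. *)
    rewrite arcsH => odda; apply: contraLR gcd_dvd_a => evH.
    have /gcdn_idPl-> : 2 %| #|H| - 1 by rewrite dvdn2.
    by rewrite dvdn2 odda.
  case: ifP => // /(ntadj _ _ nAB)[t [tH At AtV]]; rewrite At => oddt.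
  have [_ _ /(_ _ oddt) oddm _] := mxt t.
  by rewrite -[X in arcs _ _ _ _ X]At AtV arcsE.
(* The map sending [y] to [y * x^-1] turns neighbours of [x] in [H] into arcs of [S] leaving
   [H x^-1]. *)
have card_nbr x :
    #|[set y in H | cayley S x y]| = #|[set t in S | src t == src x^-1]|.
  rewrite -(card_rcoset [set y in H | cayley S x y] x^-1).
  congr #|pred_of_set _|; apply/setP=> t.
  rewrite mem_rcoset !inE /cayley invgK mulgK andbC; congr (_ && _).
  apply/idP/eqP => [txH|tx].
    by apply: rcoset_eqP; rewrite mem_rcoset invgK.
  by rewrite -[x]invgK -mem_rcoset; apply/rcoset_eqP.
exists S; split=> //.
  by apply/subsetP=> t /(subsetP sSE); rewrite !inE andbT.
split=> x xH; rewrite card_nbr (card_arcs_row invg).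
  (* Arcs leaving [H] end in [H], so only the entry [a] survives. *)
  have xVH : src x^-1 = H by apply/eqP; rewrite srcH groupV.
  rewrite xVH (bigD1 (H : {set gT})) //= cardS /c !eqxx /=.
  rewrite big1 ?addn0 // => B BH.
  rewrite cardS /c eqxx (negbTE BH) /=; case: ifP => // /existsP[t].
  rewrite srcH => /andP[tH /eqP BtV]; case/negP: BH.
  by rewrite -BtV srcH groupV.
set t := x^-1; have tH : t \notin H by rewrite groupV.
(* Only cosets in the class of [H t^-1] are reached from [H t]; over these the sum is a full matrix
   row. *)
rewrite (bigID (mem (class (src t^-1)))) /= addnC.
rewrite big1 ?add0n => [|B nB]; last first.
  rewrite cardS /c srcH (negbTE tH) /=; case: ifP => // /existsP[s].
  case/andP=> /eqP st /eqP sB; case/negP: nB.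
  by rewrite -sB; apply: mem_rcoset_class.
have [_ _ _ mxb] := mxt t^-1.
rewrite -(mxb (r (src t))) => [|]; last first.
  by rewrite card_class_inv /r cardE index_mem mem_enum orbit_refl.
rewrite -(big_index_enum _ (mx _ _)); apply: eq_bigr => B BC.
rewrite cardS /c srcH (negbTE tH) /=.
have [s st sB] := class_arcs BC.
have -> : adj (src t) B by apply/existsP; exists s; rewrite /src st sB !eqxx.
by rewrite /r -(card_class_inv H t) [class B](orbit_eqP BC).
Qed.
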